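(* Let $P_{5,2}$ denote the Petersen graph. For any triangle-free cubic graph $G$ and every $\lambda \in (0,1]$, \[ \alpha_G(\lambda) \ge \alpha_{P_{5,2}}(\lambda), \] where $\alpha_G(\lambda)$ denotes the occupancy fraction of the hard-core model on $G$ at fugacity $\lambda$. Moreover (for each $\lambda\in(0,1]$) equality holds if and only if $G$ is a disjoint union of copies of $P_{5,2}$.
   Context: All graphs are finite, simple and non-empty. A graph is cubic if it is $3$-regular. Let $\mathcal I(G)$ be the set of all independent sets of $G$ (including the empty set). The independence polynomial of $G$ is $P_G(\lambda)=\sum_{I\in\mathcal I(G)}\lambda^{|I|}$. For $\lambda>0$, the hard-core model on $G$ at fugacity $\lambda$ is the probability distribution on $\mathcal I(G)$ given by $\Pr[I]=\lambda^{|I|}/P_G(\lambda)$. The occupancy fraction is \[ \alpha_G(\lambda)=\frac{1}{|V(G)|}\,\mathbb E|I|=\frac{\lambda P_G'(\lambda)}{|V(G)|\,P_G(\lambda)}, \] where $I$ is drawn from the hard-core model. The Petersen graph $P_{5,2}$ is the usual $3$-regular, vertex-transitive graph on $10$ vertices of girth $5$. ''$G$ is a (disjoint) union of copies of $H$'' means that every connected component of $G$ is isomorphic to $H$. *)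

(* Defs.v *)
From mathcomp Require Import all_boot all_order all_algebra.
From mathcomp Require Import reals.

Set Implicit Arguments.
Unset Strict Implicit.
Unset Printing Implicit Defensive.

Import Order.TTheory GRing.Theory Num.Theory.
Local Open Scope ring_scope.

(* All graphs are finite, simple and non-empty; the last condition matters,
   since division by zero is total. *)
Record sgraph := SGraph {
  vertex :> finType;
  adj : rel vertex;
  adj_sym : symmetric adj;
  adj_irrefl : irreflexive adj;
  vertex_gt0 : (0 < #|vertex|)%N
}.

Definition cubic (G : sgraph) : Prop :=
  forall x : G, #|[set y | adj x y]| = 3%N.

Definition triangle_free (G : sgraph) : Prop :=
  forall x y z : G, ~ [/\ adj x y, adj y z & adj x z].

Definition isomorphic (G H : sgraph) : Prop :=
  exists2 f : G -> H, bijective f & forall x y, adj (f x) (f y) = adj x y.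

Section Induced.

Variables (G : sgraph) (A : {set G}).

Definition induced_adj : rel {x : G | x \in A} :=
  fun u v => adj (val u) (val v).

Lemma induced_adj_sym : symmetric induced_adj.
Proof. by move=> u v; apply: adj_sym. Qed.

Lemma induced_adj_irrefl : irreflexive induced_adj.
Proof. by move=> u; apply: adj_irrefl. Qed.

Lemma induced_vertex_gt0 : A != set0 -> (0 < #|{: {x : G | x \in A}}|)%N.
Proof. by rewrite card_sig card_gt0. Qed.

Definition induced (A_neq0 : A != set0) : sgraph :=
  SGraph induced_adj_sym induced_adj_irrefl (induced_vertex_gt0 A_neq0).

End Induced.

Definition component (G : sgraph) (x : G) : {set G} :=
  [set y | connect (@adj G) x y].

Lemma component_neq0 (G : sgraph) (x : G) : component x != set0.
Proof. by apply/set0Pn; exists x; rewrite inE. Qed.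

(* Every connected component is the component of one of its vertices. *)
Definition union_of_copies (H G : sgraph) : Prop :=
  forall x : G, isomorphic (induced (component_neq0 x)) H.

(* The generalized Petersen graph with parameters 5 and 2: [(false, i)] is the
   i-th vertex of the outer 5-cycle, and [(true, i)] is the vertex of the inner
   pentagram joined to it by a spoke. *)
Definition petersen_adj : rel (bool * 'Z_5) := fun u v =>
  match u, v with
  | (false, i), (false, j) => (j == i + 1) || (i == j + 1)
  | (true, i), (true, j) => (j == i + 2) || (i == j + 2)
  | (_, i), (_, j) => i == j
  end.

Lemma petersen_adj_sym : symmetric petersen_adj.
Proof.
move=> [[] i] [[] j] /=; first exact: orbC; [exact: eq_sym..|exact: orbC].
Qed.

Lemma petersen_adj_irrefl : irreflexive petersen_adj.
Proof.
move=> [[] i] /=; rewrite orbb; apply/negbTE; rewrite -{1}[i]addr0;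
  by rewrite (inj_eq (addrI i)).
Qed.

Lemma petersen_gt0 : (0 < #|{: bool * 'Z_5}|)%N.
Proof. by rewrite card_prod card_bool card_ord. Qed.

Definition petersen : sgraph :=
  SGraph petersen_adj_sym petersen_adj_irrefl petersen_gt0.

Definition independent (G : sgraph) (I : {set G}) : bool :=
  [forall x in I, forall y in I, ~~ adj x y].

Definition indep_sets (G : sgraph) : {set {set G}} :=
  [set I | independent I].

Definition indep_poly (R : realType) (G : sgraph) : {poly R} :=
  \sum_(I in indep_sets G) 'X^#|I|.

(* Probability mass at an independent set; only evaluated at such sets. *)
Definition hard_core (R : realType) (G : sgraph) (lambda : R) (I : {set G}) : R :=
  lambda ^+ #|I| / (indep_poly R G).[lambda].

Definition occupancy_fraction (R : realType) (G : sgraph) (lambda : R) : R :=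
  #|G|%:R^-1 * \sum_(I in indep_sets G) hard_core lambda I * #|I|%:R.

Lemma indep_poly_gt0 (R : realType) (G : sgraph) (lambda : R) :
  0 < lambda -> 0 < (indep_poly R G).[lambda].
Proof.
move=> l0; rewrite horner_sum (bigD1 (set0 : {set G})) /=; last first.
  by rewrite inE; apply/forallP => x; rewrite inE.
rewrite cards0 hornerXn expr0 ltr_wpDr // sumr_ge0 // => I _.
by rewrite hornerXn exprn_ge0 // ltW.
Qed.

Lemma hard_core_sum1 (R : realType) (G : sgraph) (lambda : R) :
  0 < lambda -> \sum_(I in indep_sets G) hard_core lambda I = 1.
Proof.
move=> l0; rewrite -mulr_suml.
have -> : \sum_(I in indep_sets G) lambda ^+ #|I| = (indep_poly R G).[lambda].
  by rewrite horner_sum; apply: eq_bigr => I _; rewrite hornerXn.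
by rewrite divff // gt_eqF // indep_poly_gt0.
Qed.

Lemma occupancy_fractionE (R : realType) (G : sgraph) (lambda : R) :
  occupancy_fraction G lambda =
    lambda * (indep_poly R G)^`().[lambda] / (#|G|%:R * (indep_poly R G).[lambda]).
Proof.
rewrite /occupancy_fraction invfM [RHS]mulrCA; congr (_ * _).
rewrite /indep_poly raddf_sum [in RHS]horner_sum -/(indep_poly R G).
rewrite mulr_sumr mulr_suml; apply: eq_bigr => I _ /=.
rewrite derivXn hornerMn hornerXn /hard_core mulrAC; congr (_ / _).
by case: #|I| => [|n]; rewrite ?mulr0 // mulr_natr exprS mulrnAr.
Qed.

(* Main.v *)
(* The proof is by linear programming duality.  For a vertex v and an
   independent set I let [occ I v] be the number of neighbours of v in I.  In a
   cubic graph, the numbers of vertices v and of pairs (v, neighbour u of v) at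
   which [occ] takes a given value agree up to a factor 3, so the weighted
   average over I of
     excess I v = 20 D [v in I] - 20 N
       + sum_(d = 1, 2) M_d (3 [occ I v = d] - sum_(u ~ v) [occ I u = d])
   summed over v is 20 D |V| (alpha_G - N / D), where N / D is the occupancy
   fraction of the Petersen graph and M_1, M_2 are dual multipliers.  Now fix v
   and the part K of I outside the ball of radius 2 around v.  What is left is
   a polynomial in lambda that depends only on which of the six slots at
   distance 2 are not blocked by K, and on which of these slots coincide or are
   adjacent.  An enumeration of these local views shows that in the Bernstein
   basis of [0, 1] the polynomial has nonnegative coefficients, the last one
   positive, except for the views of the Petersen graph, where it vanishes. *)

From Stdlib Require Import BinInt.
Require Import Defs.
From mathcomp Require Import all_boot all_order all_algebra.
From mathcomp Require Import reals.
From mathcomp Require Import ssrZ zify ring.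

Set Implicit Arguments.
Unset Strict Implicit.
Unset Printing Implicit Defensive.

Import Order.TTheory GRing.Theory Num.Theory.

(** * Integer polynomials and the computable check of all local views *)

Fixpoint zadd (p q : seq Z) : seq Z :=
  match p, q with
  | [::], _ => q
  | _, [::] => p
  | a :: p', b :: q' => Z.add a b :: zadd p' q'
  end.
Definition zscale (a : Z) (p : seq Z) : seq Z := map (Z.mul a) p.
Definition zshift n (p : seq Z) : seq Z := ncons n Z0 p.

Fixpoint bits n : seq bitseq :=
  if n is n'.+1 then map (cons false) (bits n') ++ map (cons true) (bits n')
  else [:: [::]].

(* Polynomials are lists of coefficients, constant term first.  [zdenom] is the
   independence polynomial of the Petersen graph and [znumer / zdenom] its
   occupancy fraction. *)
Definition zdenom : seq Z := map Z.of_nat [:: 1; 10; 30; 30; 5].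
Definition znumer : seq Z := map Z.of_nat [:: 0; 1; 6; 9; 2].
(* The dual multipliers, scaled by [20 * zdenom].  They were found by numerical
   optimisation; near l = 1 there is little room for them. *)
Definition zmult1 : seq Z := map Z.of_nat [:: 0; 0; 20; 101].
Definition zmult2 : seq Z := map Z.of_nat [:: 0; 0; 0; 100; 34].

(* The centre v and its neighbours u_0, u_1, u_2 have the bits [t], and the other
   neighbours w_(2i), w_(2i+1) of u_i have the bits [y]. *)
Definition zdefect (d : nat) (t : bitseq) (y : bitseq) : Z :=
  let o i := Z.b2z (eqn (nth false t 0 + nth false y i.*2 + nth false y i.*2.+1) d) in
  Z.sub (Z.mul (Z.of_nat 3) (Z.b2z (eqn (nth false t 1 + nth false t 2 + nth false t 3) d)))
   (Z.add (o 0) (Z.add (o 1) (o 2))).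

(** The coefficient list of [excess] at the centre, which the bits of the ball determine; see
    [zeval_zlocal]. *)
Definition zlocal (t y : bitseq) : seq Z :=
  zadd (zscale (Z.mul (Z.of_nat 20) (Z.b2z (nth false t 0))) zdenom)
  (zadd (zscale (Z.opp (Z.of_nat 20)) znumer)
  (zadd (zscale (zdefect 1 t y) zmult1) (zscale (zdefect 2 t y) zmult2))).

(** Only edges from the centre to the [u_i], and from [u_i] to its own slots, are tested here. Edges
    among slots depend on the view and are left to [compat]. *)
Definition core_ok (t y : bitseq) : bool :=
  ~~ (nth false t 0 && [|| nth false t 1, nth false t 2 | nth false t 3]) &&
  all (fun i => ~~ (nth false t i.+1 && (nth false y i.*2 || nth false y i.*2.+1))) (iota 0 3).

Definition zcore (y : bitseq) : seq Z :=
  foldr (fun t => zadd (zshift (count id t) (zlocal t y))) [::]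
    [seq t <- bits 4 | core_ok t y].

(** Slots below the same [u_i] are distinct and, without triangles, nonadjacent, so only the other
    pairs vary. Ordering by the larger index completes triples early in the search, which helps the
    pruning. *)
Definition slot_pairs : seq (nat * nat) :=
  [seq p <- [seq (a, b) | b <- iota 0 6, a <- iota 0 b] | p.1./2 != p.2./2].

(* The relation of two slots is coded by 0 (distinct and nonadjacent), 1
   (adjacent), 2 (the same vertex), or 3 (not yet decided). *)
Definition upd (rel : nat * nat -> nat) p t := fun q => if q == p then t else rel q.
Definition lookup (rel : nat * nat -> nat) a b :=
  if a./2 == b./2 then 0 else if a < b then rel (a, b) else rel (b, a).

(** The arguments are the relations of ab, bc and ac. Coinciding vertices stand in the same relation
    to the third one, and triangles are excluded; an undecided relation refutes nothing. *)
Definition tri_ok p q r :=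
  [|| eqn p 3, eqn q 3, eqn r 3 |
   [&& ~~ eqn p 2 || eqn q r, ~~ eqn q 2 || eqn p r, ~~ eqn r 2 || eqn p q &
       ~~ [&& eqn p 1, eqn q 1 & eqn r 1]]].
Definition consistent rel (p : nat * nat) :=
  all (fun c => [|| c == p.1, c == p.2 |
        tri_ok (lookup rel p.1 p.2) (lookup rel p.2 c) (lookup rel p.1 c)]) (iota 0 6).

Definition compat (p : nat * nat) (t : nat) (y : bitseq) :=
  match t with
  | 1 => ~~ (nth false y p.1 && nth false y p.2)
  | 2 => nth false y p.1 == nth false y p.2
  | _ => true
  end.

(* [ys] lists the sets of occupied slots that are still possible.  The
   conditional must not be a boolean connective, which [vm_compute] would
   evaluate strictly, defeating the pruning. *)
Fixpoint explore (leaf : (nat * nat -> nat) -> seq bitseq -> bool) ps rel ys :=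
  if ps is p :: ps' then
    all (fun t => let rel' := upd rel p t in
      if consistent rel' p then explore leaf ps' rel' (filter (compat p t) ys) else true)
     (iota 0 3)
  else leaf rel ys.

(** Coinciding slots are a single vertex, which must enter [weight] once; it is charged to the
    smallest of their indices. *)
Definition first_slot fps (rel : nat * nat -> nat) a :=
  ~~ has (fun p : nat * nat => (p.2 == a) && (rel p == 2)) fps.
Definition first_slots fps rel := map (first_slot fps rel) (iota 0 6).
Definition weight (fs y : bitseq) := count id (mask y fs).

Fixpoint binrow d : seq Z :=
  if d is d'.+1 then let r := binrow d' in zadd r (Z0 :: r) else [:: Z.of_nat 1].
Fixpoint binrows d : seq (seq Z) :=
  if d is d'.+1 then binrow d :: binrows d' else [:: binrow 0].
(* The coefficients of [p] in the basis l ^ i * (1 - l) ^ (d - i), where row k of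
   [rows] lists the binomial coefficients of d - k. *)
Fixpoint bern (rows : seq (seq Z)) (p : seq Z) : seq Z :=
  match rows, p with
  | row :: rows', a :: p' => zadd (zscale a row) (Z0 :: bern rows' p')
  | _, _ => [::]
  end.

Definition nocc (y : bitseq) i := nth false y i.*2 + nth false y i.*2.+1.
Definition core_index y := 9 * nocc y 0 + (3 * nocc y 1 + nocc y 2).
(* [zcore y] depends on [y] only through [core_index y]. *)
Definition core_table : seq (seq Z) :=
  map zcore
  (flatten [seq [seq [:: 0 < n.1; 1 < n.1; 0 < n.2; 1 < n.2; 0 < c; 1 < c] | c <- iota 0 3]
    | n <- [seq (a, b) | a <- iota 0 3, b <- iota 0 3]]).
Definition zslack tbl fs ys : seq Z :=
  foldr (fun y => zadd (zshift (weight fs y)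
    (nth [::] tbl (core_index y)))) [::] ys.

(* What the relations of the [slot_pairs] can be around a vertex of the Petersen
   graph, over all orders of its neighbours and of the slots. *)
Definition petersen_codes : seq (seq nat) :=
  [:: [:: 0; 1; 1; 0; 0; 1; 0; 1; 1; 0; 1; 0]; [:: 0; 1; 1; 0; 1; 0; 1; 0; 0; 1; 0; 1];
      [:: 1; 0; 0; 1; 0; 1; 1; 0; 1; 0; 0; 1]; [:: 1; 0; 0; 1; 1; 0; 0; 1; 0; 1; 1; 0]].

(** A choice allowed by [core_ok] has at most seven true bits, reached by the centre with all six
    slots, and [zlocal] has degree at most 4; hence the degree 11. The [petersen_codes] have twelve
    entries, so only a view with all slots free can match one. *)
Definition view_ok rows tbl fps rel ys :=
  let s := zslack tbl (first_slots fps rel) ys in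
  let b := bern rows s in
  (size s <= 12) &&
  if map rel fps \in petersen_codes then all (Z.eqb Z0) b
  else all (Z.leb Z0) b && Z.ltb Z0 (nth Z0 b 11).

Definition free_pairs (fr : bitseq) :=
  [seq p <- slot_pairs | nth false fr p.1 && nth false fr p.2].
(** A blocked slot is never occupied, so its relations do not affect the polynomial and keep the
    value 3. *)
Definition check_free rows tbl fr :=
  let fps := free_pairs fr in
  explore (view_ok rows tbl fps) fps (fun _ => 3)
    [seq y <- bits 6 | all (fun a => ~~ nth false y a || nth false fr a) (iota 0 6)].

Lemma check_all : all (check_free (binrows 11) core_table) (bits 6).
Proof. by vm_compute. Qed.

(** Exchanging the two slots below some [u_i] changes neither [core_ok] nor [zdefect], so 27 entries
    serve all 64 choices of [y]. *)
Lemma core_table_nth :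
  all (fun y => nth [::] core_table (core_index y) == zcore y) (bits 6).
Proof. by vm_compute. Qed.

Local Open Scope ring_scope.

(** * Bernstein positivity *)

Section Evaluation.

Variables (R : realType) (l : R).

Definition of_Z (a : Z) : R := (int_of_Z a)%:~R.

Lemma of_ZD a b : of_Z (Z.add a b) = of_Z a + of_Z b.
Proof. by rewrite /of_Z -!rmorphD. Qed.

Lemma of_ZM a b : of_Z (Z.mul a b) = of_Z a * of_Z b.
Proof. by rewrite /of_Z -!rmorphM. Qed.

Lemma of_ZN a : of_Z (Z.opp a) = - of_Z a.
Proof. by rewrite /of_Z -!rmorphN. Qed.

Lemma of_Zb b : of_Z (Z.b2z b) = b%:R.
Proof. by case: b. Qed.

Definition zeval (p : seq Z) : R := foldr (fun a r => of_Z a + l * r) 0 p.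

Lemma zeval_add p q : zeval (zadd p q) = zeval p + zeval q.
Proof.
elim: p q => [|a p IHp] [|b q] /=; rewrite ?add0r ?addr0 //.
by rewrite IHp of_ZD mulrDr addrACA.
Qed.

Lemma zeval_scale a p : zeval (zscale a p) = of_Z a * zeval p.
Proof.
elim: p => [|b p IHp] /=; first by rewrite mulr0.
by rewrite IHp of_ZM mulrDr mulrCA.
Qed.

Lemma zeval_shift n p : zeval (zshift n p) = l ^+ n * zeval p.
Proof.
elim: n => [|n IHn] /=; first by rewrite mul1r.
by rewrite -/(zshift n p) IHn add0r exprS mulrA.
Qed.

Lemma zeval_sum (T : Type) (F : T -> seq Z) s :
  zeval (foldr (fun t => zadd (F t)) [::] s) = \sum_(t <- s) zeval (F t).
Proof. by elim: s => [|t s IHs]; rewrite ?big_nil ?big_cons //= zeval_add IHs. Qed.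

(** The sum of b_i l^i (1 - l)^(n - i). The truncation in [n.-1] is harmless while [b] has at most n
    + 1 entries. *)
Fixpoint bern_eval n (b : seq Z) : R :=
  if b is a :: b' then of_Z a * (1 - l) ^+ n + l * bern_eval n.-1 b' else 0.

Lemma bern_evalD n b c : bern_eval n (zadd b c) = bern_eval n b + bern_eval n c.
Proof.
elim: b c n => [|x b IHb] [|y c] n /=; rewrite ?add0r ?addr0 //.
by rewrite IHb of_ZD mulrDr mulrDl addrACA.
Qed.

Lemma bern_evalZ n a b : bern_eval n (zscale a b) = of_Z a * bern_eval n b.
Proof.
elim: b n => [|x b IHb] n /=; first by rewrite mulr0.
by rewrite IHb of_ZM mulrDr -mulrA (mulrCA l).
Qed.

Lemma bern_evalS n b : (size b <= n.+1)%N ->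
  bern_eval n.+1 b = (1 - l) * bern_eval n b.
Proof.
elim: b n => [|x b IHb] n /=; first by rewrite mulr0.
rewrite ltnS; case: n => [|n] sb.
  by case: b {IHb} sb => //= _; rewrite mulr0 !addr0 expr1 mulr1 mulrC.
by rewrite IHb // mulrDr exprS; congr (_ + _); ring.
Qed.

Lemma size_zadd p q : size (zadd p q) = maxn (size p) (size q).
Proof. by elim: p q => [|a p IHp] [|b q] //=; rewrite ?maxn0 ?IHp ?maxnSS. Qed.

Lemma size_binrow n : size (binrow n) = n.+1.
Proof. by elim: n => //= n IHn; rewrite size_zadd /= IHn; lia. Qed.

(** The value is (l + (1 - l))^n, expanded by Pascal's rule. In [bern_sound] this identity in degree
    n - k raises the monomial l^k to degree n. *)
Lemma bern_eval_binrow n : bern_eval n (binrow n) = 1.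
Proof.
elim: n => [|n IHn]; first by rewrite /= mulr0 addr0 mulr1.
rewrite [binrow _]/= bern_evalD bern_evalS ?size_binrow // IHn /= IHn /of_Z /=.
by ring.
Qed.

Lemma bern_sound n p : (size p <= n.+1)%N ->
  bern_eval n (bern (binrows n) p) = zeval p.
Proof.
elim: p n => [|a p IHp] n; first by case: n.
move=> /=; rewrite ltnS; case: n => [|n] sp.
  case: p sp {IHp} => //= _.
  by rewrite /= !(of_ZD, of_ZM) /of_Z /= -[Pos.to_nat 1]/1%N; ring.
rewrite [binrows _]/= [bern _ _]/= bern_evalD bern_evalZ -/(binrow n.+1).
by rewrite bern_eval_binrow /= IHp // /of_Z /=; ring.
Qed.

Lemma of_Z_ge0 a : Z.leb Z0 a -> 0 <= of_Z a.
Proof. by move=> a0; rewrite /of_Z ler0z; lia. Qed.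

Lemma of_Z_gt0 a : Z.ltb Z0 a -> 0 < of_Z a.
Proof. by move=> a0; rewrite /of_Z ltr0z; lia. Qed.

Lemma bern_eval_ge0 n b : 0 < l <= 1 -> all (Z.leb Z0) b -> 0 <= bern_eval n b.
Proof.
move=> /andP[l0 l1]; elim: b n => //= a b IHb n /andP[a0 b0].
by rewrite addr_ge0 ?mulr_ge0 ?of_Z_ge0 ?exprn_ge0 ?subr_ge0 ?IHb ?(ltW l0).
Qed.

(** Entry n belongs to l^n, the only basis polynomial that does not vanish at l = 1; its positivity
    gives strictness on all of (0, 1]. *)
Lemma bern_eval_gt0 n b : 0 < l <= 1 -> all (Z.leb Z0) b -> Z.ltb Z0 (nth Z0 b n) ->
  0 < bern_eval n b.
Proof.
move=> l01; elim: b n => [|a b IHb] n /=; first by rewrite nth_nil.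
move=> /andP[a0 b0]; have /andP[l0 l1] := l01.
case: n => [|n] /= bn; last first.
  by rewrite ltr_wpDl ?mulr_gt0 ?mulr_ge0 ?of_Z_ge0 ?exprn_ge0 ?subr_ge0 ?IHb.
by rewrite ltr_pwDl ?mulr1 ?of_Z_gt0 ?mulr_ge0 ?bern_eval_ge0 ?(ltW l0).
Qed.

Lemma bern_eval_eq0 n b : all (Z.eqb Z0) b -> bern_eval n b = 0.
Proof.
elim: b n => //= a b IHb n /andP[a0 b0]; have <- : Z0 = a by apply/Z.eqb_eq.
by rewrite IHb // /of_Z mul0r mulr0 addr0.
Qed.

End Evaluation.

(** * The enumeration of local views *)

Section Exploration.

Variables (leaf : (nat * nat -> nat) -> seq bitseq -> bool) (r : nat * nat -> nat).

(** The search is followed along the branch of the true relation [r]. Consistency is tested on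
    partly filled tables, so it must hold for every such part of [r]. *)
Lemma exploreP (ps : seq (nat * nat)) rel ys :
    (forall p, p \in ps -> (r p < 3)%N) ->
    (forall rel' p, (forall q, rel' q = 3%N \/ rel' q = r q) -> p \in ps ->
      consistent rel' p) ->
    (forall q, rel q = 3%N \/ rel q = r q) ->
    explore leaf ps rel ys ->
  exists rel', [/\ forall q, q \in ps \/ rel q = r q -> rel' q = r q &
     leaf rel' [seq y <- ys | all (fun p => compat p (r p) y) ps]].
Proof.
elim: ps rel ys => [|p ps IHps] rel ys r3 rc relr.
  move=> ly; exists rel; split; last by rewrite filter_predT.
  by move=> q [].
move=> /(@allP _ _ (iota 0 3)) ex; have := ex (r p).
rewrite mem_iota /= add0n r3 ?mem_head // => /(_ isT) {ex}.
have relr' q : upd rel p (r p) q = 3%N \/ upd rel p (r p) q = r q.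
  by rewrite /upd; case: eqP => [->|_]; [right|].
rewrite rc ?mem_head // => /IHps [].
- by move=> q qps; rewrite r3 // inE qps orbT.
- by move=> rel' q ? qps; rewrite rc // inE qps orbT.
- by [].
move=> rel' [relE lf]; exists rel'; split=> [q|].
  rewrite inE => -[/orP[/eqP->|qps]|rq]; apply: relE; [right|by left|right].
    by rewrite /upd eqxx.
  by rewrite /upd; case: eqP => [->|].
rewrite -filter_predI in lf; congr (leaf _ _): lf.
by apply: eq_filter => y /=; rewrite andbC.
Qed.

End Exploration.

(** * Local views *)

Lemma mem_bits n s : (s \in bits n) = (size s == n).
Proof.
elim: n s => [|n IHn] [|b s] //=; first by rewrite mem_cat; apply/norP; split; apply/mapP => -[].
rewrite mem_cat eqSS -IHn; apply/orP/idP => [[]/mapP[t tn [_ ->]] //|sn].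
by case: b; [right|left]; apply: map_f.
Qed.

Lemma bits_uniq n : uniq (bits n).
Proof.
elim: n => //= n IHn; rewrite cat_uniq !map_inj_uniq ?IHn ?andbT => //; try by move=> ? ? [].
by apply/hasPn => s /mapP[t _ ->]; apply/mapP => -[].
Qed.

Lemma big_bits (V : nmodType) n (P : pred bitseq) (F : bitseq -> V) :
  \sum_(x : n.-tuple bool | P x) F x = \sum_(s <- bits n | P s) F s.
Proof.
rewrite -(big_map (@tval n bool) P F); apply: perm_big; apply: uniq_perm => [||s].
- by rewrite (map_inj_uniq val_inj) index_enum_uniq.
- exact: bits_uniq.
rewrite mem_bits; apply/mapP/idP => [[x _ ->]|sn]; first by rewrite size_tuple.
by exists (Tuple sn); rewrite ?mem_index_enum.
Qed.

Lemma big_bits_cat (V : nmodType) m n (P : pred bitseq) (F : bitseq -> V) :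
  \sum_(s <- bits (m + n) | P s) F s =
    \sum_(t <- bits m) \sum_(y <- bits n | P (t ++ y)) F (t ++ y).
Proof.
elim: m P F => [|m IHm] P F; first by rewrite big_seq1.
by rewrite addSn /= !big_cat !big_map !IHm.
Qed.

(** [K] is the part of [I] off the list. As [L] may repeat vertices, several bit vectors can
    describe the same trace; the last condition keeps the one that is read off from the trace. *)
Lemma sum_over_ball (T : finType) (V : nmodType) n (L : n.-tuple T)
    (P : pred {set T}) (F : {set T} -> V) :
  \sum_(I | P I) F I = \sum_(K : {set T} | [disjoint K & L])
    \sum_(x : n.-tuple bool | P (K :|: [set z in mask x L]) &&
        (map [in [set z in mask x L]] L == x))
      F (K :|: [set z in mask x L]).
Proof.
rewrite (partition_big (fun I => I :\: [set z in L])
  [pred K : {set T} | [disjoint K & L]]); last first.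
  move=> I _; rewrite /= disjoint_subset; apply/subsetP => z.
  by rewrite !inE => /andP[].
apply: eq_bigr => K /= KL.
have maskL (x : n.-tuple bool) z : z \in mask x L -> z \in L by apply: mem_mask.
have disjK z : z \in L -> z \in K = false.
  by move=> zL; apply: contraTF zL => /(disjointFr KL) ->.
rewrite (reindex_onto (fun x : n.-tuple bool => K :|: [set z in mask x L])
    (fun I => [tuple of map [in I] L])) /=; last first.
  move=> I /andP[_ /eqP <-]; apply/setP => z; rewrite !inE -filter_mask mem_filter /=.
  by case: (z \in L); rewrite ?andbT ?andbF ?orbF.
apply: eq_bigl => x.
have -> : (K :|: [set z in mask x L]) :\: [set z in L] == K.
  apply/eqP/setP => z; rewrite !inE; have [zL|zL] := boolP (z \in L).
    by rewrite disjK.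
  by rewrite [z \in mask _ _](contraNF (maskL x z)) ?orbF.
rewrite andbT; congr (_ && _); rewrite -val_eqE /=; congr (_ == _).
by apply/eq_in_map => z zL; rewrite /= !inE disjK.
Qed.

(** Slots below different [u i] may coincide or be adjacent. Only the arguments below 3 of [u] and
    below 6 of [w] matter. *)
Record labelling (G : sgraph) (v : G) (u w : nat -> G) : Prop := Labelling {
  adj_center : forall x, adj v x = (x \in map u (iota 0 3));
  adj_inner : forall i x, (i < 3)%N -> adj (u i) x = (x \in [:: v; w i.*2; w i.*2.+1]);
  inner_uniq : uniq (map u (iota 0 3));
  outer_uniq : forall i, (i < 3)%N -> uniq [:: v; w i.*2; w i.*2.+1]
}.

(** By regularity, three distinct neighbours of a vertex are all of them. *)
Lemma cubic_labelling (G : sgraph) (v : G) (u w : nat -> G) : cubic G ->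
    all (adj v) (map u (iota 0 3)) -> uniq (map u (iota 0 3)) ->
    (forall i, (i < 3)%N -> all (adj (u i)) [:: v; w i.*2; w i.*2.+1]) ->
    (forall i, (i < 3)%N -> uniq [:: v; w i.*2; w i.*2.+1]) ->
  labelling v u w.
Proof.
move=> cG vu uu uw uw'.
have nbrs (x : G) s : all (adj x) s -> uniq s -> size s = 3%N -> adj x =i s.
  move=> xs us s3 y; have : [set z in s] == [set y | adj x y].
    rewrite eqEcard cG cardsE (card_uniqP us) s3 leqnn andbT.
    by apply/subsetP => z; rewrite !inE => /(allP xs).
  by move/eqP/setP/(_ y); rewrite !inE.
split=> // [x|i x i3]; first exact: (nbrs v).
by apply: nbrs; rewrite ?uw ?uw'.
Qed.

Lemma labelling_exists (G : sgraph) (v : G) : cubic G ->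
  exists u w, labelling v u w.
Proof.
move=> cG.
have enum_nbrs (x : G) : exists f : nat -> G,
    all (adj x) (map f (iota 0 3)) /\ uniq (map f (iota 0 3)).
  exists (nth x (enum [set y | adj x y])).
  have -> : map (nth x (enum [set y | adj x y])) (iota 0 3) = enum [set y | adj x y].
    by rewrite -[3%N](cG x) cardE; apply: mkseq_nth.
  by split; [apply/allP => y; rewrite mem_enum inE|apply: enum_uniq].
have [u [vu uu]] := enum_nbrs v.
have other (x y : G) : adj x y -> exists f : nat -> G,
    all (adj x) [:: y; f 0%N; f 1%N] /\ uniq [:: y; f 0%N; f 1%N].
  move=> xy; pose s := enum ([set z | adj x z] :\ y).
  have s2 : size s = 2%N
    by rewrite -cardE; have := cardsD1 y [set z | adj x z]; rewrite cG inE xy => -[].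
  exists (nth x s); have sy : y \notin s by rewrite mem_enum !inE eqxx.
  have sx : all (adj x) s by apply/allP => z; rewrite mem_enum !inE => /andP[].
  have us : uniq s by apply: enum_uniq.
  case: s s2 sy sx us => // a [|b []] // _ sy sx us.
  by rewrite /= xy; split; [case/and3P: sx => -> -> _|rewrite -/(uniq [:: a; b]) us andbT].
have /and4P[/other[f0 [a0 u0]] /other[f1 [a1 u1]] /other[f2 [a2 u2]] _] :
  [&& adj (u 0) v, adj (u 1) v, adj (u 2) v & true].
  by move: vu; rewrite /= !(adj_sym v).
exists u, (nth v [:: f0 0; f0 1; f1 0; f1 1; f2 0; f2 1])%N.
by apply: cubic_labelling => // -[|[|[|i]]].
Qed.

Definition slot_code (G : sgraph) (w : nat -> G) (p : nat * nat) : nat :=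
  (if w p.1 == w p.2 then 2 else adj (w p.1) (w p.2))%N.

Definition free_slots (G : sgraph) (w : nat -> G) (K : {set G}) : bitseq :=
  [seq [disjoint K & adj (w a)] | a <- iota 0 6].

Definition ball (G : sgraph) (v : G) (u w : nat -> G) : seq G :=
  (v :: map u (iota 0 3)) ++ map w (iota 0 6).

Section Local.

Variables (G : sgraph) (v : G) (u w : nat -> G).
Hypotheses (Gfree : triangle_free G) (lab : labelling v u w).

Lemma adj_vu i : (i < 3)%N -> adj v (u i).
Proof. by move=> i3; rewrite (adj_center lab) map_f // mem_iota. Qed.

Lemma half3 a : (a < 6)%N -> (a./2 < 3)%N.
Proof. by lia. Qed.

Lemma adj_uw a : (a < 6)%N -> adj (u a./2) (w a).
Proof.
move=> a6; rewrite (adj_inner lab) ?half3 // !inE.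
by rewrite -[in w a](odd_double_half a); case: (odd a); rewrite eqxx ?orbT.
Qed.

Lemma u_inj i j : (i < 3)%N -> (j < 3)%N -> u i = u j -> i = j.
Proof.
move=> i3 j3 uij; apply/eqP; rewrite -(nth_uniq v _ _ (inner_uniq lab)) ?size_map ?size_iota //.
by rewrite !(nth_map 0%N) ?size_iota // !nth_iota // uij.
Qed.

Lemma w_neq_v a : (a < 6)%N -> w a != v.
Proof.
move=> a6; have := outer_uniq lab (half3 a6); rewrite /= !inE negb_or -!andbA => /and4P[v0 v1 _ _].
by rewrite eq_sym -[in w a](odd_double_half a); case: (odd a).
Qed.

Lemma wv_nadj a : (a < 6)%N -> adj v (w a) = false.
Proof.
by move=> a6; apply/negP => va; apply: (Gfree (And3 (adj_vu (half3 a6)) (adj_uw a6) va)).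
Qed.

Lemma uu_nadj i j : (i < 3)%N -> (j < 3)%N -> adj (u i) (u j) = false.
Proof.
move=> i3 j3; apply/negP => uij.
by apply: (Gfree (And3 (adj_vu i3) uij (adj_vu j3))).
Qed.

Lemma u_neq_w i a : (i < 3)%N -> (a < 6)%N -> u i != w a.
Proof. by move=> i3 a6; apply: contraFneq (wv_nadj a6) => <-; apply: adj_vu. Qed.

Lemma u_neq_v i : (i < 3)%N -> u i != v.
Proof. by move=> i3; apply: contraTneq (adj_vu i3) => ->; rewrite adj_irrefl. Qed.

Lemma w_inj_half a b : (a < 6)%N -> (b < 6)%N -> a./2 = b./2 -> w a = w b -> a = b.
Proof.
move=> a6 b6 ab; have := outer_uniq lab (half3 a6).
rewrite /= !inE negb_or -!andbA => /and4P[_ _ nw _] wab.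
have [oab|] := eqVneq (odd a) (odd b).
  by rewrite -(odd_double_half a) oab ab odd_double_half.
move: wab nw; rewrite -[in w a](odd_double_half a) -[in w b](odd_double_half b) -ab.
by case: (odd a); case: (odd b) => //= ->; rewrite eqxx.
Qed.

Lemma w_nadj_half a b : (a < 6)%N -> (b < 6)%N -> a./2 = b./2 -> adj (w a) (w b) = false.
Proof.
move=> a6 b6 ab; apply/negP => wab.
by apply: (Gfree (And3 (adj_uw a6) wab _)); rewrite ab adj_uw.
Qed.

Lemma adj_u_cases i x : (i < 3)%N -> adj (u i) x ->
  x = v \/ exists a, [/\ (a < 6)%N, a./2 = i & x = w a].
Proof.
move=> i3; rewrite (adj_inner lab) // !inE => /or3P[] /eqP->; [by left|right..].
  by exists i.*2; rewrite doubleK; split=> //; lia.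
by exists i.*2.+1; split=> //; lia.
Qed.

End Local.

Lemma mem_maskP (T : eqType) (x0 : T) (m : bitseq) (s : seq T) z :
  reflect (exists i, [/\ (i < size s)%N, nth false m i & z = nth x0 s i]) (z \in mask m s).
Proof.
elim: s m z => [|x s IHs] [|b m] z;
  try by rewrite ?mask0 /=; constructor=> -[i []]; rewrite ?nth_nil.
rewrite mask_cons mem_cat; apply: (iffP orP) => [[]|[[|i] [/= si mi ->]]].
- by case: b; rewrite // inE => /eqP->; exists 0%N.
- by case/IHs => i [si mi ->]; exists i.+1.
- by left; rewrite mi mem_head.
- by right; apply/IHs; exists i.
Qed.

Lemma mem_slot_pairs p :
  (p \in slot_pairs) = (p.1 < p.2 < 6)%N && (p.1./2 != p.2./2).
Proof.
rewrite mem_filter andbC; congr (_ && _); apply/allpairsPdep/idP.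
  by case=> b [a []]; rewrite !mem_iota /= !add0n => b6 ab ->; rewrite /= ab b6.
case: p => a b /andP[/= ab b6]; exists b, a; split=> //; last by rewrite mem_iota.
by rewrite -[[:: _; _; _; _; _; _]]/(iota 0 6) mem_iota.
Qed.

Lemma core_okP t y : reflect
  [/\ forall i, (i < 3)%N -> nth false t 0 -> ~~ nth false t i.+1 &
      forall a, (a < 6)%N -> nth false t a./2.+1 -> ~~ nth false y a] (core_ok t y).
Proof.
apply: (iffP andP) => [[t0 /allP ty]|[t0 ty]]; split.
- by move=> i i3 ht0; apply: contra t0 => ti; rewrite ht0;
    case: i i3 ti => [|[|[|]]] //= _ ->; rewrite ?orbT.
- move=> a a6 ta; have /ty : a./2 \in iota 0 3 by rewrite mem_iota; lia.
  rewrite ta negb_or => /andP[]; rewrite -{3}(odd_double_half a).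
  by case: (odd a).
- by apply/negP => /andP[ht0]; case/or3P; apply/negP; apply: t0.
- apply/allP => i; rewrite mem_iota /= add0n => i3; apply/negP => /andP[ti].
  by case/orP; apply/negP/ty; rewrite /= ?doubleK ?uphalf_double //; lia.
Qed.

(** * Independent sets extending a given part outside the ball *)

Definition admissible (fr : bitseq) (r : nat * nat -> nat) (y : bitseq) : bool :=
  all (fun a => ~~ nth false y a || nth false fr a) (iota 0 6) &&
  all (fun p => compat p (r p) y) (free_pairs fr).

Lemma mem_ball_v (G : sgraph) (v : G) u w : v \in ball v u w.
Proof. by rewrite mem_cat mem_head. Qed.

Lemma mem_ball_w (G : sgraph) (v : G) u w a : (a < 6)%N -> w a \in ball v u w.
Proof. by move=> a6; rewrite mem_cat (map_f w) ?orbT // mem_iota. Qed.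

Section Core.

Variables (G : sgraph) (v : G) (u w : nat -> G).
Hypotheses (Gfree : triangle_free G) (lab : labelling v u w).
Variables (t y : bitseq).
Hypotheses (t4 : size t = 4%N) (y6 : size y = 6%N).

Let S := [set z in mask (t ++ y) (ball v u w)].

Lemma mem_core z : reflect [\/ z = v /\ nth false t 0,
      exists i, [/\ (i < 3)%N, z = u i & nth false t i.+1] |
      exists a, [/\ (a < 6)%N, z = w a & nth false y a]] (z \in S).
Proof.
rewrite inE; apply: (iffP (mem_maskP v _ _ _)) => [[i []]|[]].
- rewrite size_cat /= nth_cat t4 => i10; case: ltnP => i4 xi ->.
    case: i i4 xi {i10} => [|i] i4 xi; first by constructor 1.
    by constructor 2; exists i; split=> //; case: i i4 {xi} => [|[|[|]]].
  constructor 3; exists (i - 4)%N; split=> //; first by rewrite ltn_subLR.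
  by case: i i4 i10 {xi} => [|[|[|[|[|[|[|[|[|[|i]]]]]]]]]].
- by case=> -> t0; exists 0%N; rewrite nth_cat t4.
- case=> i [i3 -> ti]; exists i.+1; rewrite size_cat nth_cat t4 /= ltnS i3 !ltnS.
  by split=> //; [lia|case: i i3 {ti} => [|[|[|]]]].
- case=> a [a6 -> ya]; exists (4 + a)%N; rewrite size_cat nth_cat t4 /=; split=> //.
  - by rewrite addnC addnK.
  - by case: a a6 {ya} => [|[|[|[|[|[|]]]]]].
Qed.

Definition coherent := forall a b, (a < 6)%N -> (b < 6)%N -> w a = w b ->
  nth false y a = nth false y b.

Lemma mem_core_v : (v \in S) = nth false t 0.
Proof.
apply/mem_core/idP => [[[]|[i [i3 vu _]]|[a [a6 vw _]]] //|t0]; last by constructor 1.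
  by have := u_neq_v lab i3; rewrite -vu eqxx.
by have := w_neq_v lab a6; rewrite -vw eqxx.
Qed.

Lemma mem_core_u i : (i < 3)%N -> (u i \in S) = nth false t i.+1.
Proof.
move=> i3; apply/mem_core/idP => [[[uv _]|[j [j3 uu]]|[a [a6 uw _]]] //|ti].
- by have := u_neq_v lab i3; rewrite uv eqxx.
- by rewrite (u_inj lab i3 j3 uu).
- by have := u_neq_w Gfree lab i3 a6; rewrite uw eqxx.
- by constructor 2; exists i.
Qed.

Lemma mem_core_w a : coherent -> (a < 6)%N -> (w a \in S) = nth false y a.
Proof.
move=> coh a6; apply/mem_core/idP => [[[wv _]|[j [j3 wu _]]|[b [b6 ww]]] //|ya].
- by have := w_neq_v lab a6; rewrite wv eqxx.
- by have := u_neq_w Gfree lab j3 a6; rewrite wu eqxx.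
- by rewrite (coh a b).
- by constructor 3; exists a.
Qed.

(** The centre and the [u i] differ from each other and from all slots, so bits can only conflict at
    coinciding slots. *)
Lemma coherentP : reflect coherent (map [in S] (ball v u w) == t ++ y).
Proof.
apply: (iffP eqP) => [sat a b a6 b6 wab|coh].
  have nthw c : (c < 6)%N -> nth false y c = (w c \in S).
    move=> c6; have := congr1 (fun s => nth false s (4 + c)) sat.
    rewrite nth_cat t4 /= addKn => <-; by case: c c6 => [|[|[|[|[|[|]]]]]].
  by rewrite !nthw // wab.
apply: (@eq_from_nth _ false); first by rewrite size_map !size_cat t4 y6.
move=> i; rewrite size_map => i10; rewrite (nth_map v) // nth_cat t4.
case: ltnP => i4.
  case: i i4 {i10} => [|i] i4; first exact: mem_core_v.
  by rewrite -mem_core_u //; case: i i4 => [|[|[|]]].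
rewrite -mem_core_w // ?ltn_subLR //.
by case: i i4 i10 => [|[|[|[|[|[|[|[|[|[|]]]]]]]]]].
Qed.

End Core.

Section Condition.

Variables (G : sgraph) (v : G) (u w : nat -> G) (K : {set G}).
Hypotheses (Gfree : triangle_free G) (lab : labelling v u w).
Hypothesis K_ball : [disjoint K & ball v u w].

Let fr := free_slots w K.
Let r := slot_code w.

Lemma nth_free a : (a < 6)%N -> nth false fr a = [disjoint K & adj (w a)].
Proof. by move=> a6; rewrite (nth_map 0%N) ?size_iota // nth_iota. Qed.

Lemma mem_free_pairs p : (p \in free_pairs fr) =
  [&& (p.1 < p.2 < 6)%N, p.1./2 != p.2./2, nth false fr p.1 & nth false fr p.2].
Proof. by rewrite mem_filter mem_slot_pairs andbC -andbA. Qed.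

Variables (t y : bitseq).
Hypotheses (t4 : size t = 4%N) (y6 : size y = 6%N).

Let S := [set z in mask (t ++ y) (ball v u w)].

Let S_v : (v \in S) = nth false t 0.
Proof. exact: mem_core_v. Qed.

Let S_u i : (i < 3)%N -> (u i \in S) = nth false t i.+1.
Proof. exact: mem_core_u. Qed.

Let S_w a : coherent w y -> (a < 6)%N -> (w a \in S) = nth false y a.
Proof. exact: mem_core_w. Qed.

(** Coinciding slots are both free or both blocked. If free, [compat] with code 2 equates their
    bits; if blocked, both bits are false. *)
Lemma admissible_coherent : admissible fr r y -> coherent w y.
Proof.
move=> /andP[/allP yfr /allP yc] a b; wlog ab : a b / (a < b)%N.
  move=> ih a6 b6 wab; have [ab|ba|->] // := ltngtP a b; first exact: ih.
  by apply/esym/ih.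
move=> a6 b6 wab.
have half_ab : a./2 != b./2.
  by apply: contraTneq ab => /(w_inj_half lab a6 b6)/(_ wab)->; rewrite ltnn.
have yfr' c : (c < 6)%N -> nth false y c -> nth false fr c.
  by move=> c6 yc'; have := yfr c; rewrite mem_iota yc' => /(_ c6).
have frab : nth false fr a = nth false fr b by rewrite !nth_free // wab.
have [frb|nfrb] := boolP (nth false fr b); last first.
  rewrite (contraNF (yfr' b b6)) // (contraNF (yfr' a a6)) //.
  by rewrite frab.
have /yc : (a, b) \in free_pairs fr by rewrite mem_free_pairs /= ab b6 half_ab frab frb.
by rewrite /r /slot_code /= wab eqxx /= => /eqP.
Qed.

(** All neighbours of the centre and of the [u i] lie in the ball, so [K] can only meet neighbours
    of slots, which freeness rules out. Inside the ball [core_ok] and [compat] cover the possible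
    edges; triangle-freeness excludes those between two [u i], from the centre to a slot and between
    sibling slots. *)
Lemma core_independent : independent K ->
  independent (K :|: S) && (map [in S] (ball v u w) == t ++ y) =
  core_ok t y && admissible fr r y.
Proof.
move=> indK; apply/andP/andP =>
  [[/forall_inP ind /(coherentP Gfree lab t4 y6) coh]|[/core_okP[t0 ty] adm]].
  have indep x z : x \in K :|: S -> z \in K :|: S -> ~~ adj x z.
    by move=> xI zI; have /forall_inP/(_ z zI) := ind x xI.
  have indS x z : x \in S -> z \in S -> ~~ adj x z.
    by move=> xS zS; apply: indep; rewrite inE ?xS ?zS orbT.
  split.
    apply/core_okP; split=> [i i3 t0|a a6 ta].
      apply/negP => ti; have := indS v (u i); rewrite S_v S_u // => /(_ t0 ti).
      by rewrite (adj_vu lab).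
    apply/negP => ya; have := indS (u a./2) (w a).
    by rewrite S_u ?half3 // S_w // => /(_ ta ya); rewrite (adj_uw lab).
  apply/andP; split.
    apply/allP => a; rewrite mem_iota /= add0n => a6; rewrite -implybE; apply/implyP => ya.
    rewrite nth_free //; apply/pred0P => z /=; apply/negbTE/negP => /andP[zK wz].
    by have := indep (w a) z; rewrite !inE -[_ \in mask _ _]in_set S_w // ya zK orbT
      [adj _ _]wz => /(_ isT isT).
  apply/allP => -[a b]; rewrite mem_free_pairs /= => /and3P[/andP[ab b6] _ _].
  have a6 := ltn_trans ab b6; rewrite /r /slot_code /=.
  case: eqP => [wab|_] /=; first by rewrite (coh a b).
  case wab: (adj _ _) => //=; apply/negP => /andP[ya yb].
  by have := indS (w a) (w b); rewrite !S_w // wab => /(_ ya yb).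
have coh := admissible_coherent adm; split; last exact/(coherentP Gfree lab t4 y6).
have KS x z : x \in K -> z \in S -> ~~ adj z x.
  move=> xK /(mem_core v u w t4 y6) zS; apply/negP;
    case: zS => [[-> _]|[i [i3 -> _]]|[a [a6 -> ya]]].
  - rewrite (adj_center lab) => xu; have := disjointFr K_ball xK.
    by rewrite /ball mem_cat inE xu orbT.
  - by case/(adj_u_cases lab i3) => [xv|[a [a6 _ xw]]];
      have := disjointFr K_ball xK; rewrite ?xv ?xw ?mem_ball_v ?mem_ball_w.
  - case/andP: adm => /allP/(_ a); rewrite mem_iota /= add0n => /(_ a6).
    by rewrite ya nth_free // => /disjointFr/(_ xK) wx _; rewrite -[adj _ _]/(x \in adj (w a)) wx.
apply/forall_inP => x xI; apply/forall_inP => z zI.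
move: xI zI; rewrite ![_ \in K :|: S]in_setU => /orP[xK|xS] /orP[zK|zS].
- by have /forall_inP/(_ x xK)/forall_inP/(_ z zK) := indK.
- by rewrite adj_sym KS.
- by rewrite KS.
(* The slot [w a] may be a neighbour of [u i] under another index b; coherence carries its bit
   over. *)
have uwS i a : (i < 3)%N -> (a < 6)%N -> nth false t i.+1 -> nth false y a -> ~~ adj (u i) (w a).
  move=> i3 a6 ti ya; apply/negP => /(adj_u_cases lab i3)[wv|[b [b6 bi wab]]].
    by have := w_neq_v lab a6; rewrite wv eqxx.
  by have := ty b b6; rewrite bi -(coh a b) // ya => /(_ ti).
case/(mem_core v u w t4 y6): xS => [[-> xt]|[i [i3 -> xt]]|[a [a6 -> xy]]];
  case/(mem_core v u w t4 y6): zS => [[-> zt]|[j [j3 -> zt]]|[b [b6 -> zy]]].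
- by rewrite adj_irrefl.
- by have := t0 j j3 xt; rewrite zt.
- by rewrite (wv_nadj Gfree lab).
- by have := t0 i i3 zt; rewrite xt.
- by rewrite (uu_nadj Gfree lab).
- exact: uwS.
- by rewrite adj_sym (wv_nadj Gfree lab).
- by rewrite adj_sym uwS.
wlog ab : a b a6 b6 xy zy / (a < b)%N.
  move=> ih; have [ab|ba|->] := ltngtP a b; first exact: ih.
    by rewrite adj_sym; apply: ih.
  by rewrite adj_irrefl.
have [abh|abh] := eqVneq a./2 b./2; first by rewrite (w_nadj_half Gfree lab).
case/andP: adm => /allP yfr /allP/(_ (a, b)).
have := yfr a; have := yfr b; rewrite !mem_iota xy zy => /(_ b6) /= frb /(_ a6) /= fra.
rewrite mem_free_pairs /= ab b6 abh fra frb => /(_ isT).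
rewrite /r /slot_code /=; case: eqP => [->|_ /=]; first by rewrite adj_irrefl.
by case: (adj _ _) => //=; rewrite xy zy.
Qed.

End Condition.

(** * Excess and cardinality in terms of the bits *)

Definition occ (G : sgraph) (I : {set G}) (x : G) : nat := #|[set z in I | adj x z]|.

Lemma occ_count (G : sgraph) (I : {set G}) x s : uniq s -> adj x =i s ->
  occ I x = count [in I] s.
Proof.
move=> us xs; rewrite -size_filter -(card_uniqP (filter_uniq _ us)).
by apply: eq_card => z; rewrite !inE mem_filter -xs.
Qed.

Definition occ_defect (R : realType) (G : sgraph) d (I : {set G}) (v : G) : R :=
  3 * (occ I v == d)%:R - \sum_(x | adj v x) (occ I x == d)%:R.

Definition excess (R : realType) (l : R) (G : sgraph) (I : {set G}) (v : G) : R :=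
  20 * (v \in I)%:R * zeval l zdenom - 20 * zeval l znumer +
  (occ_defect R 1 I v * zeval l zmult1 + occ_defect R 2 I v * zeval l zmult2).

Lemma of_Z_nat (R : realType) n : of_Z R (Z.of_nat n) = n%:R.
Proof. by rewrite /of_Z (Z_of_intK n). Qed.

Section Value.

Variables (R : realType) (l : R).
Variables (G : sgraph) (v : G) (u w : nat -> G) (K : {set G}).
Hypotheses (Gfree : triangle_free G) (lab : labelling v u w).
Hypothesis K_ball : [disjoint K & ball v u w].

Let fr := free_slots w K.
Let r := slot_code w.

Variables (t y : bitseq).
Hypotheses (t4 : size t = 4%N) (y6 : size y = 6%N).
Hypothesis coh : coherent w y.

Let S := [set z in mask (t ++ y) (ball v u w)].

Lemma mem_union_ball z : z \in ball v u w -> (z \in K :|: S) = (z \in S).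
Proof.
by move=> zb; rewrite inE; case zK: (z \in K); rewrite // (disjointFr K_ball zK) in zb.
Qed.

Lemma mem_ball_u i : (i < 3)%N -> u i \in ball v u w.
Proof. by move=> i3; rewrite mem_cat inE (map_f u) ?orbT // mem_iota. Qed.

Lemma occ_center : occ (K :|: S) v = (nth false t 1 + nth false t 2 + nth false t 3)%N.
Proof.
rewrite (occ_count _ (inner_uniq lab) (adj_center lab)) /=.
by rewrite !mem_union_ball ?mem_ball_u // !mem_core_u // addn0 addnA.
Qed.

Lemma occ_inner i : (i < 3)%N ->
  occ (K :|: S) (u i) = (nth false t 0 + nth false y i.*2 + nth false y i.*2.+1)%N.
Proof.
move=> i3; rewrite (occ_count _ (outer_uniq lab i3) (fun x => adj_inner lab x i3)) /=.
have i6 : (i.*2.+1 < 6)%N by lia.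
rewrite !mem_union_ball ?mem_ball_v ?mem_ball_w // ?(ltnW i6) //.
by rewrite (mem_core_v lab) // !(mem_core_w Gfree lab) // ?(ltnW i6) // addn0 addnA.
Qed.

Lemma of_zdefect d : of_Z R (zdefect d t y) = occ_defect R d (K :|: S) v.
Proof.
rewrite /zdefect /occ_defect.
have -> : \sum_(x | adj v x) (occ (K :|: S) x == d)%:R =
   \sum_(i <- iota 0 3) (occ (K :|: S) (u i) == d)%:R :> R.
  rewrite -(big_map u xpredT (fun x => (occ (K :|: S) x == d)%:R)) big_uniq ?(inner_uniq lab) //.
  by apply: eq_bigl => x; rewrite (adj_center lab).
rewrite [iota _ _]/= !big_cons big_nil addr0 occ_center !occ_inner //.
by rewrite /Z.sub of_ZD of_ZN !of_ZD of_ZM !of_Zb of_Z_nat !eqnE.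
Qed.

Lemma zeval_zlocal : zeval l (zlocal t y) = excess l (K :|: S) v.
Proof.
rewrite /zlocal !zeval_add !zeval_scale !of_zdefect of_ZM of_ZN of_Zb !of_Z_nat.
by rewrite /excess mem_union_ball ?mem_ball_v // (mem_core_v lab) // mulNr addrA.
Qed.

(** By coherence the smallest index of an occupied slot is occupied too, so [fs] selects exactly one
    index for each occupied vertex. *)
Lemma card_mask_outer (fs : bitseq) :
    (forall a, (a < 6)%N -> nth false y a ->
      nth false fs a = [forall b : 'I_6, (b < a)%N ==> (w b != w a)]) -> size fs = 6%N ->
  #|[set z in mask y (map w (iota 0 6))]| = weight fs y.
Proof.
move=> fsE fs6; set s := mask y (iota 0 6).
have sE a : (a \in s) = (a < 6)%N && nth false y a.
  apply/(mem_maskP 0%N)/andP => [[i []]|[a6 ya]]; last first.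
    by exists a; rewrite size_iota nth_iota.
  by rewrite size_iota => i6 yi ->; rewrite nth_iota.
have us : uniq s by rewrite mask_uniq ?iota_uniq.
have -> : weight fs y = size (filter (nth false fs) s).
  rewrite size_filter /weight -{1}[fs](@mkseq_nth _ false) fs6 /mkseq -map_mask count_map.
  by apply: eq_count.
rewrite -(size_map w) -map_mask -(card_uniqP _).
  rewrite cardsE; apply: eq_card => z; apply/mapP/mapP => -[a]; last first.
    by rewrite mem_filter => /andP[_ aS] ->; exists a.
  rewrite sE => /andP[a6 ya] ->.
  have ex : exists b, (b < 6)%N && (w b == w a) by exists a; rewrite a6 eqxx.
  case: (ex_minnP ex) => b /andP[b6 /eqP wb] bmin.
  have yb : nth false y b by rewrite (coh b6 a6 wb).
  exists b; rewrite ?mem_filter ?sE ?b6 ?yb ?fsE //= ?andbT.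
  apply/forallP => c; apply/implyP => cb; apply/eqP => wc.
  by have := bmin c; rewrite ltn_ord wc wb eqxx leqNgt cb => /(_ isT).
rewrite map_inj_in_uniq ?filter_uniq // => a b.
rewrite !mem_filter !sE => /and3P[fa a6 ya] /and3P[fb b6 yb] wab.
have neq c d : (c < 6)%N -> (d < 6)%N -> nth false y d -> nth false fs d -> (c < d)%N -> w c <> w d.
  move=> c6 d6 yd; rewrite fsE // => /forallP/(_ (Ordinal c6))/implyP fd cd.
  exact/eqP/fd.
have [ab|ba|//] := ltngtP a b; first by have := neq _ _ a6 b6 yb fb ab.
by case: (neq _ _ b6 a6 ya fa ba).
Qed.

Lemma card_core : admissible fr r y ->
  #|K :|: S| = (#|K| + (count id t + weight (first_slots (free_pairs fr) r) y))%N.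
Proof.
move=> /andP[/allP yfr _]; rewrite cardsU (_ : K :&: S = set0) ?cards0 ?subn0; last first.
  apply/setP => z; rewrite !inE; apply/negP => /andP[zK /mem_mask].
  by rewrite (disjointFr K_ball zK).
congr (_ + _)%N; rewrite /S mask_cat ?t4 //.
have -> : [set z in mask t (v :: map u (iota 0 3)) ++ mask y (map w (iota 0 6))] =
    [set z in mask t (v :: map u (iota 0 3))] :|: [set z in mask y (map w (iota 0 6))].
  by apply/setP => z; rewrite !inE mem_cat.
rewrite cardsU (_ : _ :&: _ = set0) ?cards0 ?subn0; last first.
  apply/setP => z; rewrite !inE; apply/negP => /andP[/mem_mask zT /mem_mask/mapP[a]].
  rewrite mem_iota /= => a6 zw; move: zT; rewrite zw inE (negPf (w_neq_v lab a6)) orFb.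
  case/mapP => i; rewrite mem_iota /= => i3 wu.
  by have := u_neq_w Gfree lab i3 a6; rewrite wu eqxx.
congr (_ + _)%N.
  have uT : uniq (v :: map u (iota 0 3)).
    rewrite cons_uniq (inner_uniq lab) andbT; apply/mapP => -[i]; rewrite mem_iota /= => i3 vu.
    by have := u_neq_v lab i3; rewrite -vu eqxx.
  by rewrite cardsE (card_uniqP (mask_uniq uT _)) size_mask.
apply: card_mask_outer; rewrite ?size_map ?size_iota // => a a6 ya.
have yfr' c : (c < 6)%N -> nth false y c -> nth false fr c.
  by move=> c6 yc'; have := yfr c; rewrite mem_iota yc' => /(_ c6).
rewrite (nth_map 0%N) ?size_iota // nth_iota // add0n.
apply/idP/forallP => [/hasPn nh b|nh].
  apply/implyP => ba; apply/negP => /eqP wba; have b6 := ltn_trans ba a6.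
  have /nh : (b : nat, a) \in free_pairs fr.
    rewrite mem_free_pairs /= ba a6 !yfr' ?(coh b6 a6 wba) // !andbT.
    by apply: contraTneq ba => /(w_inj_half lab b6 a6)/(_ wba)->; rewrite ltnn.
  by rewrite /r /slot_code /= eqxx wba eqxx.
apply/hasPn => -[b c]; rewrite mem_free_pairs /= => /and3P[/andP[bc c6] _ _].
apply/negP => /andP[/eqP ca]; rewrite {}ca in bc c6 *.
have := nh (Ordinal (ltn_trans bc c6)); rewrite /= bc /r /slot_code /=.
by case: (w b == w a); case: (adj (w b) (w a)).
Qed.

End Value.

Definition view_poly (fr : bitseq) (r : nat * nat -> nat) : seq Z :=
  zslack core_table (first_slots (free_pairs fr) r) [seq y <- bits 6 | admissible fr r y].

Lemma independentS (G : sgraph) (A B : {set G}) : A \subset B -> independent B -> independent A.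
Proof.
move=> /subsetP AB /forall_inP indB; apply/forall_inP => x /AB/indB/forall_inP indx.
by apply/forall_inP => y /AB/indx.
Qed.

Lemma zeval_zcore (R : realType) (l : R) y :
  zeval l (zcore y) = \sum_(t <- bits 4 | core_ok t y) l ^+ count id t * zeval l (zlocal t y).
Proof.
rewrite /zcore zeval_sum big_filter.
by apply: eq_bigr => t _; rewrite zeval_shift.
Qed.

(** * The sum of the excess at one vertex and its sign *)

Section LocalSum.

Variables (R : realType) (l : R) (G : sgraph) (v : G) (u w : nat -> G).
Hypotheses (Gfree : triangle_free G) (lab : labelling v u w).

(** For fixed [K], the view constrains and weighs only the slot bits [y]. The four bits [t] can
    therefore be summed first, which gives the tabulated [zcore y]. *)
Lemma local_sum :
  \sum_(I in indep_sets G) l ^+ #|I| * excess l I v =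
  \sum_(K : {set G} | [disjoint K & ball v u w] && independent K)
    l ^+ #|K| * zeval l (view_poly (free_slots w K) (slot_code w)).
Proof.
rewrite (eq_bigl (@independent G)) => [|I]; last by rewrite inE.
rewrite (sum_over_ball [tuple of ball v u w]) big_mkcondr /=.
apply: eq_bigr => K KB; case: ifPn => [indK|nindK]; last first.
  apply: big1 => x /andP[indKS _]; case/negP: nindK.
  by apply: independentS indKS; apply: subsetUl.
set fr := free_slots w K; set r := slot_code w.
pose S x := K :|: [set z in mask x (ball v u w)].
rewrite (big_bits 10 (fun x => independent (S x) &&
    (map [in [set z in mask x (ball v u w)]] (ball v u w) == x))
   (fun x => l ^+ #|S x| * excess l (S x) v)) (big_bits_cat 4 6).
transitivity (\sum_(t <- bits 4) \sum_(y <- bits 6 | core_ok t y && admissible fr r y)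
    l ^+ #|K| * (l ^+ weight (first_slots (free_pairs fr) r) y *
      (l ^+ count id t * zeval l (zlocal t y)))).
  apply: eq_big_seq => t; rewrite mem_bits => /eqP t4.
  rewrite big_seq_cond [RHS]big_seq_cond; apply: eq_big => [y|y /andP[]].
    rewrite mem_bits; case: eqP => // y6 /=.
    by rewrite (core_independent Gfree lab KB t4 y6 indK).
  rewrite mem_bits => /eqP y6; rewrite (core_independent Gfree lab KB t4 y6 indK) => /andP[_ adm].
  have coh := admissible_coherent lab adm.
  rewrite (zeval_zlocal _ Gfree lab KB t4 y6 coh) (card_core Gfree lab KB t4 coh adm).
  by rewrite !exprD -!mulrA; congr (_ * _); rewrite mulrCA.
under eq_bigr => t _ do rewrite big_mkcondr.
rewrite (exchange_big_dep xpredT) // /view_poly /zslack zeval_sum mulr_sumr big_filter.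
rewrite [RHS]big_mkcond; apply: eq_big_seq => y; rewrite mem_bits => y6.
case: ifP => _; last by rewrite big1.
rewrite -!mulr_sumr -zeval_zcore zeval_shift.
have /allP/(_ y) := core_table_nth; rewrite mem_bits => /(_ y6) /eqP ->.
by [].
Qed.

Variable K : {set G}.

Let fr := free_slots w K.
Let r := slot_code w.

Lemma slot_code_sym a b : r (a, b) = r (b, a).
Proof. by rewrite /r /slot_code /= eq_sym adj_sym. Qed.

Lemma tri_ok_code a b c : tri_ok (r (a, b)) (r (b, c)) (r (a, c)).
Proof.
rewrite /r /slot_code /=.
have [->|ab] := eqVneq (w a) (w b).
  by case: eqP => // _; case: adj.
have [<-|bc] := eqVneq (w b) (w c).
  by rewrite (negPf ab); case: adj.
have [<-|ac] := eqVneq (w a) (w c).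
  by rewrite [adj (w b) _]adj_sym; case: adj.
case ab': (adj (w a) (w b)); case bc': (adj (w b) (w c)); case ac': (adj (w a) (w c)) => //.
by case: (Gfree (And3 ab' bc' ac')).
Qed.

Lemma lookup_code rel a b : (forall q, rel q = 3%N \/ rel q = r q) -> (a < 6)%N -> (b < 6)%N ->
  a != b -> lookup rel a b = 3%N \/ lookup rel a b = r (a, b).
Proof.
move=> relr a6 b6 ab; rewrite /lookup; case: eqP => [abh|_].
  right; rewrite /r /slot_code /= (w_nadj_half Gfree lab) //.
  by case: eqP => // /(w_inj_half lab a6 b6 abh) eab; rewrite eab eqxx in ab.
by case: ltnP => _; [|rewrite slot_code_sym]; apply: relr.
Qed.

Lemma consistent_code rel p : (forall q, rel q = 3%N \/ rel q = r q) -> p \in free_pairs fr ->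
  consistent rel p.
Proof.
move=> relr; case: p => a b; rewrite mem_free_pairs /= => /and3P[/andP[ab b6] _ _].
have a6 := ltn_trans ab b6.
apply/allP => c; rewrite mem_iota /= add0n => c6.
have [//|ca] := eqVneq c a; have [//|cb] := eqVneq c b; rewrite /=.
have bc : b != c by rewrite eq_sym.
have ac : a != c by rewrite eq_sym.
have [->|->] := lookup_code relr a6 b6 (negbT (ltn_eqF ab)); first by [].
have [->|->] := lookup_code relr b6 c6 bc; first by rewrite /tri_ok /= !orbT.
have [->|->] := lookup_code relr a6 c6 ac; first by rewrite /tri_ok /= !orbT.
exact: tri_ok_code.
Qed.

(** This is [check_all] at the pattern of free slots of [K]; [exploreP] leads to the leaf of the
    actual slot relations. *)
Lemma view_sign : 0 < l <= 1 ->
  if map r (free_pairs fr) \in petersen_codes then zeval l (view_poly fr r) = 0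
  else 0 < zeval l (view_poly fr r).
Proof.
move=> l01; have /allP/(_ fr) := check_all; rewrite mem_bits size_map size_iota => /(_ isT).
case/(@exploreP _ r).
- by move=> p _; rewrite /r /slot_code; case: eqP => // _; case: adj.
- by move=> rel p relr; apply: consistent_code.
- by move=> q; left.
move=> rel [relE]; rewrite -filter_predI.
rewrite (eq_filter (a2 := admissible fr r)); last by move=> y; rewrite /= andbC.
rewrite /view_ok.
have -> : first_slots (free_pairs fr) rel = first_slots (free_pairs fr) r.
  apply: eq_map => a; congr (~~ _); apply: eq_in_has => p pf.
  by rewrite relE //; left.
have -> : map rel (free_pairs fr) = map r (free_pairs fr).
  by apply/eq_in_map => p pf; rewrite relE //; left.
rewrite -/(view_poly fr r) => /andP[s12].
rewrite -(bern_sound l s12); case: ifP => _; first exact: bern_eval_eq0.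
by move=> /andP[b0 b11]; apply: bern_eval_gt0.
Qed.

End LocalSum.

Section Sign.

Variables (R : realType) (l : R) (G : sgraph) (v : G) (u w : nat -> G).
Hypotheses (Gfree : triangle_free G) (lab : labelling v u w) (l01 : 0 < l <= 1).

Lemma free_pairs_full (K : {set G}) :
  (forall a, (a < 6)%N -> [disjoint K & adj (w a)]) ->
  free_pairs (free_slots w K) = slot_pairs.
Proof.
move=> Kw; rewrite /free_slots (_ : map _ _ = nseq 6 true) //.
by rewrite /= !Kw.
Qed.

Lemma local_term_ge0 (K : {set G}) :
  0 <= l ^+ #|K| * zeval l (view_poly (free_slots w K) (slot_code w)).
Proof.
have /andP[/ltW l0 _] := l01; rewrite mulr_ge0 ?exprn_ge0 //.
by have := view_sign Gfree lab K l01; case: ifP => _ => [->|/ltW].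
Qed.

Lemma local_ge0 : 0 <= \sum_(I in indep_sets G) l ^+ #|I| * excess l I v.
Proof.
by rewrite (local_sum _ Gfree lab); apply: sumr_ge0 => K _; apply: local_term_ge0.
Qed.

(** All terms are nonnegative, so the one for the empty [K] vanishes. There every slot is free, and
    the view shows all twelve relations. *)
Lemma local_eq0_code : \sum_(I in indep_sets G) l ^+ #|I| * excess l I v = 0 ->
  map (slot_code w) slot_pairs \in petersen_codes.
Proof.
rewrite (local_sum _ Gfree lab) => /eqP.
rewrite psumr_eq0 => [|K _]; last exact: local_term_ge0.
move=> /allP/(_ set0); rewrite mem_index_enum => /(_ isT).
have set0_disjoint (A : {pred G}) : [disjoint set0 & A].
  by rewrite disjoint_subset; apply/subsetP => x; rewrite inE.
rewrite set0_disjoint (_ : independent set0) /=; last first.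
  by apply/forall_inP => x; rewrite inE.
rewrite cards0 expr0 mul1r => /eqP e0.
have := view_sign Gfree lab set0 l01; rewrite free_pairs_full; last first.
  by move=> a _; apply: set0_disjoint.
by case: ifP => // _; rewrite e0 ltxx.
Qed.

(** When the slots have no neighbours outside the ball, no [K] blocks a slot, so every term has the
    same full view. *)
Lemma local_code_eq0 : map (slot_code w) slot_pairs \in petersen_codes ->
    (forall a, (a < 6)%N -> {subset adj (w a) <= ball v u w}) ->
  \sum_(I in indep_sets G) l ^+ #|I| * excess l I v = 0.
Proof.
move=> code closed; rewrite (local_sum _ Gfree lab); apply: big1 => K /andP[KB _].
have := view_sign Gfree lab K l01; rewrite free_pairs_full ?code => [->|a a6].
  by rewrite mulr0.
by apply: disjointWr KB; apply/subsetP/closed.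
Qed.

End Sign.

(** * Averaging over the vertices *)

Section Global.

Variables (R : realType) (l : R) (G : sgraph).
Hypotheses (Gcubic : cubic G) (l0 : 0 < l).

Lemma sum_nbr (V : zmodType) (f : G -> V) :
  \sum_x \sum_(y | adj x y) f y = (\sum_x f x) *+ 3.
Proof.
rewrite (exchange_big_dep xpredT) //= -sumrMnl; apply: eq_bigr => y _.
rewrite sumr_const -(Gcubic y); congr (_ *+ _).
by rewrite cardsE; apply: eq_card => x; exact: adj_sym.
Qed.

(** Each vertex is a neighbour of exactly three others, so the two parts of the defect balance. This
    is the linear constraint dual to the multiplier. *)
Lemma sum_occ_defect d (I : {set G}) : \sum_v occ_defect R d I v = 0.
Proof. by rewrite sumrB sum_nbr -mulr_sumr mulr_natl subrr. Qed.

Lemma sum_excess (I : {set G}) : \sum_v excess l I v =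
  20 * zeval l zdenom * #|I|%:R - 20 * zeval l znumer * #|G|%:R.
Proof.
have sumD (f g : G -> R) : \sum_x (f x + g x) = \sum_x f x + \sum_x g x.
  exact: big_split.
rewrite !sumD -!mulr_suml !sum_occ_defect !mul0r !addr0 sumrN sumr_const.
congr (_ - _); last by rewrite mulr_natr.
rewrite [RHS]mulrAC; congr (_ * _).
rewrite -sum1_card natr_sum mulr_sumr [RHS]big_mkcond; apply: eq_bigr => x _.
by case: (x \in I); rewrite ?mulr0 ?mulr1.
Qed.

Lemma zdenom_gt0 : 0 < zeval l zdenom.
Proof.
have ge0 s : 0 <= zeval l (map Z.of_nat s).
  elim: s => //= n s IHs.
  by rewrite addr_ge0 ?mulr_ge0 ?of_Z_nat ?ler0n ?(ltW l0).
have : 0 < of_Z R (Z.of_nat 1) + l * zeval l (map Z.of_nat [:: 10; 30; 30; 5]%N).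
  by rewrite of_Z_nat ltr_pwDl ?mulr_ge0 ?(ltW l0).
by [].
Qed.

(** After exchanging the sums the defects cancel for each [I], and what is left to average is affine
    in the size of [I]. *)
Lemma occupancy_excess : occupancy_fraction G l = zeval l znumer / zeval l zdenom +
  (\sum_v \sum_(I in indep_sets G) l ^+ #|I| * excess l I v) /
    (20 * zeval l zdenom * #|G|%:R * (indep_poly R G).[l]).
Proof.
have Z0 := indep_poly_gt0 G l0; have P0 := zdenom_gt0.
have n0 : 0 < #|G|%:R :> R by rewrite ltr0n vertex_gt0.
have ZE : (indep_poly R G).[l] = \sum_(I in indep_sets G) l ^+ #|I|.
  by rewrite horner_sum; apply: eq_bigr => I _; rewrite hornerXn.
rewrite exchange_big; under eq_bigr => I _ do rewrite -mulr_sumr sum_excess mulrBr.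
rewrite sumrB -mulr_suml -ZE /occupancy_fraction /hard_core.
under [in LHS]eq_bigr => I _ do rewrite mulrAC.
under [X in (X - _) / _]eq_bigr => I _ do rewrite mulrCA.
rewrite -mulr_suml -mulr_sumr; field.
by rewrite !gt_eqF.
Qed.

End Global.

(** * Copies of the Petersen graph *)

Definition petersen_enum : seq petersen :=
  [seq (b, inZp k) | b <- [:: false; true], k <- iota 0 5].

Lemma mem_petersen_enum p : p \in petersen_enum.
Proof.
case: p => b i; apply/allpairsP; exists (b, val i).
split; [by case: b|by rewrite mem_iota (ltn_ord i)|by rewrite /= valZpK].
Qed.

Lemma petersen_all (P : pred petersen) : all P petersen_enum -> forall p, P p.
Proof. by move=> /allP allP p; apply: allP; apply: mem_petersen_enum. Qed.

Definition petersen_nbrs (p : petersen) : seq petersen :=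
  let: (b, i) := p in
  if b then [:: (true, i + 2); (true, i - 2); (false, i)]
  else [:: (false, i + 1); (false, i - 1); (true, i)].

Lemma petersen_nbrsE p : adj p =i petersen_nbrs p.
Proof.
move=> q; apply/eqP; move: q; apply: petersen_all; move: p.
by apply: petersen_all; vm_compute.
Qed.

Lemma petersen_cubic : cubic petersen.
Proof.
move=> p; rewrite cardsE (eq_card (petersen_nbrsE p)); apply/eqP.
have /card_uniqP -> : uniq (petersen_nbrs p) by move: p; apply: petersen_all; vm_compute.
by case: p => [[]].
Qed.

Lemma petersen_triangle_free : triangle_free petersen.
Proof.
move=> x y z [xy yz xz]; suff : ~~ [&& adj x y, adj y z & adj x z] by rewrite xy yz xz.
move: z {yz xz}; apply: petersen_all; move: y {xy}; apply: petersen_all; move: x.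
by apply: petersen_all; vm_compute.
Qed.

Definition petersen_u (p : petersen) (i : nat) : petersen := nth p (petersen_nbrs p) i.
Definition petersen_w (p : petersen) (a : nat) : petersen :=
  nth p [seq z <- petersen_nbrs (petersen_u p a./2) | z != p] (odd a).

Definition petersen_view_ok (p : petersen) :=
  let u := petersen_u p in let w := petersen_w p in
  [&& all (adj p) (map u (iota 0 3)), uniq (map u (iota 0 3)),
      all (fun i => all (adj (u i)) [:: p; w i.*2; w i.*2.+1] && uniq [:: p; w i.*2; w i.*2.+1])
        (iota 0 3),
      map (slot_code w) slot_pairs \in petersen_codes &
      all [in ball p u w] petersen_enum].

Lemma petersen_viewP p : petersen_view_ok p.
Proof. by move: p; apply: petersen_all; vm_compute. Qed.

Section Copies.

Variables (G H : sgraph).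

(** The image contains [x] and is closed under adjacency, but [H] need not be shown connected; thus
    the identity makes the Petersen graph a copy of itself at once. *)
Record copy_at (x : G) (g : H -> G) : Prop := CopyAt {
  copy_inj : injective g;
  copy_adj : forall p q, adj (g p) (g q) = adj p q;
  copy_closed : forall p z, adj (g p) z -> exists q, z = g q;
  copy_base : exists p, g p = x
}.

Lemma isomorphic_copy (x : G) :
  isomorphic (induced (component_neq0 x)) H -> exists g, copy_at x g.
Proof.
move=> [k [k' kK k'K] kadj]; exists (fun p => val (k' p)); split.
- by move=> p q /val_inj/(can_inj k'K).
- by move=> p q; rewrite -{2}(k'K p) -{2}(k'K q) kadj.
- move=> p z pz; have zC : z \in component x.
    have := valP (k' p); rewrite !inE => xp.
    exact: connect_trans xp (connect1 pz).
  by exists (k (exist _ z zC)); rewrite kK.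
- have xC : x \in component x by rewrite inE.
  by exists (k (exist _ x xC)); rewrite kK.
Qed.

Hypotheses (Gcubic : cubic G) (Hcubic : cubic H).

(** Between cubic graphs an injective homomorphism maps the three neighbours of a vertex onto those
    of its image. Hence [g] reflects adjacency, and its image is closed under adjacency and fills
    the component. *)
Lemma copy_isomorphic (x : G) (g : H -> G) : injective g ->
    {homo g : p q / adj p q} ->
    (forall p, connect (@adj G) x (g p)) -> (exists p, g p = x) ->
  isomorphic (induced (component_neq0 x)) H.
Proof.
move=> ginj ghom gx [p0 gp0].
have gnbr p z : adj (g p) z -> exists2 q, adj p q & z = g q.
  move=> pz; have : g @: [set q | adj p q] == [set y | adj (g p) y].
    rewrite eqEcard (card_imset _ ginj) Gcubic Hcubic leqnn andbT.
    by apply/subsetP => y0 /imsetP[q]; rewrite !inE => pq ->; apply: ghom.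
  move=> /eqP/setP/(_ z); rewrite inE pz => /imsetP[q].
  by rewrite inE; exists q.
have gadj p q : adj (g p) (g q) = adj p q.
  apply/idP/idP => [pq|]; last exact: ghom.
  by have [q' pq' /ginj->] := gnbr _ _ pq.
have comp z : z \in component x -> exists p, z = g p.
  rewrite inE => /connectP[s]; elim/last_ind: s z => [|s y IHs] z /=.
    by move=> _ ->; exists p0.
  rewrite rcons_path last_rcons => /andP[xs sy] ->.
  have [p sp] := IHs _ xs erefl; rewrite sp in sy.
  by have [q _ yq] := gnbr _ _ sy; exists q.
have gC p : g p \in component x by rewrite inE.
pose k p : induced (component_neq0 x) := exist _ (g p) (gC p).
have kinj : injective k by move=> p q /(congr1 val)/ginj.
have [k' kK k'K] : bijective k.
  apply: inj_card_bij => //; rewrite card_sig -(card_codom ginj).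
  apply: subset_leq_card; apply/subsetP => z zC.
  by have [p ->] := comp z zC; apply: codom_f.
exists k'; first by exists k.
by move=> a b; rewrite -gadj -{2}(k'K a) -{2}(k'K b).
Qed.

End Copies.

Section Petersen.

Variables (G : sgraph).
Hypotheses (Gcubic : cubic G) (Gfree : triangle_free G).

Lemma copy_labelling (x : G) (g : petersen -> G) : copy_at x g -> exists u w,
  [/\ labelling x u w, map (slot_code w) slot_pairs \in petersen_codes &
      forall a, (a < 6)%N -> {subset adj (w a) <= ball x u w}].
Proof.
move=> [ginj gadj gclosed [p gp]].
have /and5P[pu uu uw code pball] := petersen_viewP p.
have ball_g : ball x (g \o petersen_u p) (g \o petersen_w p) =
  map g (ball p (petersen_u p) (petersen_w p)) by rewrite /= gp.
exists (g \o petersen_u p), (g \o petersen_w p); split.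
- apply: cubic_labelling => //.
  + apply/allP => z /mapP[i i3 ->]; rewrite -gp /= gadj.
    by move/allP: pu; apply; apply: map_f.
  + by rewrite map_comp map_inj_uniq.
  + move=> i i3; have /allP/(_ i) := uw; rewrite mem_iota => /(_ i3) /andP[/allP aw _].
    have -> : [:: x; (g \o petersen_w p) i.*2; (g \o petersen_w p) i.*2.+1] =
      map g [:: p; petersen_w p i.*2; petersen_w p i.*2.+1] by rewrite /= gp.
    by apply/allP => z /mapP[q qw ->]; rewrite /= gadj aw.
  + move=> i i3; have /allP/(_ i) := uw; rewrite mem_iota => /(_ i3) /andP[_].
    by rewrite -(map_inj_uniq ginj) /= gp.
- rewrite (_ : map _ _ = map (slot_code (petersen_w p)) slot_pairs) //.
  apply: eq_map => -[a b].
  by rewrite /slot_code /= (inj_eq ginj) gadj.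
- move=> a _ z wz; have [q ->] := gclosed _ _ wz.
  by rewrite ball_g map_f //; move/allP: pball; apply; apply: mem_petersen_enum.
Qed.

(* Adjacency of the entries i and j of a ball: 0 is the centre, 1 to 3 are its
   neighbours and 4 to 9 the slots, whose relations are given by the code [c]. *)
Definition label_adj (c : seq nat) (i j : nat) : bool :=
  match i, j with
  | 0, 0 => false
  | 0, _ => (j < 4)%N
  | _, 0 => (i < 4)%N
  | _, _ =>
    if (i < 4)%N then (4 <= j)%N && (i == (j - 4)./2.+1)%N
    else if (j < 4)%N then (j == (i - 4)./2.+1)%N
    else let p := if (i < j)%N then (i - 4, j - 4)%N else (j - 4, i - 4)%N in
      (p \in slot_pairs) && (nth 0 c (index p slot_pairs) == 1)%N
  end.

(* The i-th list places the vertices (false, 0), ..., (false, 4), (true, 0), ...,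
   (true, 4) of the Petersen graph in a ball whose code is the i-th of the
   [petersen_codes]. *)
Definition petersen_orders : seq (seq nat) :=
  [:: [:: 0; 1; 4; 7; 2; 3; 5; 9; 8; 6]; [:: 0; 1; 4; 7; 2; 3; 5; 8; 9; 6];
      [:: 0; 1; 4; 6; 2; 3; 5; 9; 8; 7]; [:: 0; 1; 4; 6; 2; 3; 5; 8; 9; 7]]%N.

Definition petersen_label (s : seq nat) (p : petersen) : nat :=
  nth 0%N s (if p.1 then 5 + val p.2 else val p.2)%N.

(** It is enough that edges go to edges; the converse comes from the degree count in
    [copy_isomorphic]. *)
Definition order_ok (c s : seq nat) : bool :=
  all (fun p => all (fun q => [&& (petersen_label s p < 10)%N,
    (petersen_label s p == petersen_label s q) ==> (p == q) &
    adj p q ==> label_adj c (petersen_label s p) (petersen_label s q)])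
    petersen_enum) petersen_enum && (petersen_label s (false, 0) == 0%N).

Lemma petersen_ordersP :
  all (fun c => has (order_ok c) petersen_orders && (2 \notin c)%N) petersen_codes.
Proof. by vm_compute. Qed.

(** The code makes the six slots a hexagon with siblings opposite. No Petersen code contains 2, so
    the ten entries of the ball are distinct, and one of the [petersen_orders] embeds the Petersen
    graph there. *)
Lemma code_copy (x : G) (u w : nat -> G) : labelling x u w ->
    map (slot_code w) slot_pairs \in petersen_codes ->
  isomorphic (induced (component_neq0 x)) petersen.
Proof.
move=> lab; set c := map _ _ => cP.
have /allP/(_ c cP)/andP[/hasP[s _ /andP[/allP sok /eqP s0]] c2] := petersen_ordersP.
have w_neq a b : (a < 6)%N -> (b < 6)%N -> (a < b)%N -> w a <> w b.
  move=> a6 b6 ab wab; have [h|h] := eqVneq a./2 b./2.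
    by move: ab; rewrite (w_inj_half lab a6 b6 h wab) ltnn.
  case/negP: c2; have abP : (a, b) \in slot_pairs by rewrite mem_slot_pairs /= ab b6.
  by apply/mapP; exists (a, b); rewrite // /slot_code /= wab eqxx.
pose f i := nth x (ball x u w) i.
have f_w a : (a < 6)%N -> f (4 + a)%N = w a by case: a => [|[|[|[|[|[|]]]]]].
have f_u i : (i < 3)%N -> f i.+1 = u i by case: i => [|[|[|]]].
have ball_uniq : uniq (ball x u w).
  rewrite cat_uniq; apply/and3P; split.
  - rewrite cons_uniq (inner_uniq lab) andbT; apply/mapP => -[i]; rewrite mem_iota => i3 xu.
    by have := u_neq_v lab i3; rewrite -xu eqxx.
  - apply/hasPn => z /mapP[a]; rewrite mem_iota => a6 ->; rewrite inE (negPf (w_neq_v lab a6)) orFb.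
    apply/mapP => -[i]; rewrite mem_iota => i3 wu.
    by have := u_neq_w Gfree lab i3 a6; rewrite wu eqxx.
  - rewrite map_inj_in_uniq ?iota_uniq // => a b; rewrite !mem_iota => a6 b6 wab.
    have [ab|ba|//] := ltngtP a b; first by case: (w_neq a b).
    by case: (w_neq b a).
have f_inj i j : (i < 10)%N -> (j < 10)%N -> f i = f j -> i = j.
  by move=> i10 j10 /eqP; rewrite nth_uniq // => /eqP.
have f_adj i j : (i < 10)%N -> (j < 10)%N -> label_adj c i j -> adj (f i) (f j).
  have slots a b : (a < 6)%N -> (b < 6)%N -> (a, b) \in slot_pairs ->
      nth 0%N c (index (a, b) slot_pairs) == 1%N -> adj (w a) (w b).
    move=> a6 b6 ab; rewrite (nth_map (0, 0)%N) ?index_mem // nth_index // /slot_code /=.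
    by case: (w a == w b); case: (adj (w a) (w b)).
  have f_uw k a : (a < 6)%N -> k = a./2.+1 -> adj (f k) (f (4 + a)%N).
    by move=> a6 ->; rewrite f_u ?half3 // f_w // (adj_uw lab).
  case: i j => [|i] [|j] // i10 j10.
  - by move=> /= j3; rewrite f_u // (adj_vu lab).
  - by move=> /= i3; rewrite f_u // adj_sym (adj_vu lab).
  rewrite /label_adj; case: ltnP => i4.
    case/andP=> j4 /eqP->; have j6 : (j.+1 - 4 < 6)%N by rewrite ltn_subLR.
    by have := f_uw _ _ j6 erefl; rewrite (subnKC j4).
  have i6 : (i.+1 - 4 < 6)%N by rewrite ltn_subLR.
  case: ltnP => j4.
    by move=> /eqP->; rewrite adj_sym; have := f_uw _ _ i6 erefl; rewrite (subnKC i4).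
  have j6 : (j.+1 - 4 < 6)%N by rewrite ltn_subLR.
  have := f_w _ i6; rewrite (subnKC i4) => ->; have := f_w _ j6; rewrite (subnKC j4) => ->.
  by case: ifP => _ /andP[]; [|rewrite adj_sym]; apply: slots.
have f_connect i : (i < 10)%N -> connect (@adj G) x (f i).
  have cu k : (k < 3)%N -> connect (@adj G) x (u k).
    by move=> k3; apply/connect1/(adj_vu lab).
  case: (ltnP i 4) => i4 i10; last first.
    have a6 : (i - 4 < 6)%N by rewrite ltn_subLR.
    rewrite -(subnKC i4) f_w //; apply: connect_trans (cu _ (half3 a6)) _.
    exact/connect1/(adj_uw lab).
  by case: i i4 {i10} => [|i] i4 //; rewrite f_u //; apply: cu.
apply: (@copy_isomorphic G petersen Gcubic petersen_cubic x (fun p => f (petersen_label s p))).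
- move=> p q /f_inj pq; have /allP/(_ _ (mem_petersen_enum q)) := sok p (mem_petersen_enum p).
  have /allP/(_ _ (mem_petersen_enum p))/and3P[q10 _ _] := sok q (mem_petersen_enum q).
  by case/and3P=> p10 /implyP inj _; apply/eqP/inj/eqP/pq.
- move=> p q pq; have /allP/(_ _ (mem_petersen_enum q)) := sok p (mem_petersen_enum p).
  have /allP/(_ _ (mem_petersen_enum p))/and3P[q10 _ _] := sok q (mem_petersen_enum q).
  by case/and3P=> p10 _ /implyP/(_ pq); apply: f_adj.
- move=> p; apply: f_connect.
  by have /allP/(_ _ (mem_petersen_enum p))/and3P[] := sok p (mem_petersen_enum p).
- by exists (false, 0); rewrite s0.
Qed.

End Petersen.

Lemma copy_local_eq0 (R : realType) (l : R) (G : sgraph) (x : G) (g : petersen -> G) :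
    cubic G -> triangle_free G -> 0 < l <= 1 -> copy_at x g ->
  \sum_(I in indep_sets G) l ^+ #|I| * excess l I x = 0.
Proof.
move=> Gcubic Gfree l01 /(copy_labelling Gcubic)[u [w [lab code closed]]].
exact: (local_code_eq0 Gfree lab).
Qed.

(** The independence polynomial is not expanded: all local sums vanish in the Petersen graph, and
    [occupancy_excess] leaves the quotient. *)
Lemma occupancy_petersen (R : realType) (l : R) : 0 < l <= 1 ->
  occupancy_fraction petersen l = zeval l znumer / zeval l zdenom.
Proof.
move=> l01; have /andP[l0 _] := l01.
rewrite (occupancy_excess petersen_cubic l0) big1 ?mul0r ?addr0 // => x _.
apply: (@copy_local_eq0 R l petersen x id petersen_cubic petersen_triangle_free l01).
by split=> // [p z _|]; [exists z|exists x].
Qed.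

Theorem theorem3 (R : realType) (G : sgraph) (lambda : R) :
  triangle_free G -> cubic G -> 0 < lambda <= 1 ->
  occupancy_fraction G lambda >= occupancy_fraction petersen lambda /\
  (occupancy_fraction G lambda = occupancy_fraction petersen lambda <->
   union_of_copies petersen G).
Proof.
move=> Gfree Gcubic l01; have /andP[l0 _] := l01.
rewrite (occupancy_petersen l01) (occupancy_excess Gcubic l0).
pose E (v : G) := \sum_(I in indep_sets G) lambda ^+ #|I| * excess lambda I v.
have E0 v : 0 <= E v.
  by have [u [w lab]] := labelling_exists v Gcubic; apply: local_ge0 lab l01.
rewrite -[\sum_v _]/(\sum_v E v); set D := 20 * _ * _ * _; have D0 : 0 < D.
  by rewrite /D !mulr_gt0 ?ltr0n ?vertex_gt0 ?zdenom_gt0 ?indep_poly_gt0.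
split; first by rewrite lerDl divr_ge0 ?(ltW D0) // sumr_ge0.
split=> [|copies].
  rewrite -[RHS]addr0 => /addrI/eqP; rewrite mulf_eq0 invr_eq0 (gt_eqF D0) orbF.
  (* The nonnegative [E v] sum to 0, so equality can be used at each vertex separately. *)
  rewrite psumr_eq0 // => /allP Ez x.
  have [u [w lab]] := labelling_exists x Gcubic.
  apply: (code_copy Gcubic Gfree lab); apply: (local_eq0_code Gfree lab l01).
  exact/eqP/Ez/mem_index_enum.
rewrite big1 ?mul0r ?addr0 // => x _.
by have [g gx] := isomorphic_copy (copies x); apply: copy_local_eq0 gx.
Qed.
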